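(* Let $L=\begin{bmatrix} A & B \\ C & D \end{bmatrix}$ be an invertible complex matrix with invertible square diagonal blocks $A,D$, such that $T=A^{-1}BD^{-1}C$ is diagonalizable, and let $m\ge1$. If the K-cycle algorithm AMGK (defined in the context) is used to precondition an optimal Krylov subspace method $\mathrm{KSM}^\star$ for a linear system with matrix $L$, then every $\mathrm{KSM}^\star$ call in the hierarchy converges to the exact solution in 2 iterations in exact arithmetic.
   Context: Let $\hat\alpha_i=\frac{1}{1-\cos(2\pi i/(2m+1))}$, $i=1,\dots,m$, and $$P=\begin{bmatrix} -A^{-1}B \\ I \end{bmatrix},\quad R=\begin{bmatrix} -CA^{-1} & I \end{bmatrix},\quad S^{-1}=\begin{bmatrix} A^{-1} & 0 \\ 0 & D^{-1} \end{bmatrix},\quad M_0=RLP=D-CA^{-1}B.$$ AMGK for the matrix $L$ sends $\mathbf v$ to the vector $\mathbf x$ computed as follows: start with $\mathbf x=0$; for $i=1,\dots,m$ do $\mathbf x\leftarrow\mathbf x+\hat\alpha_iS^{-1}(\mathbf v-L\mathbf x)$; set $\mathbf r=R(\mathbf v-L\mathbf x)$ and $\mathbf x\leftarrow\mathbf x+P\mathbf y$, where $\mathbf y=M_0^{-1}\mathbf r$ if the coarsest level has been reached, and otherwise $\mathbf y$ is the result of $\mathrm{KSM}^\star$ applied to $M_0\mathbf y=\mathbf r$ with (left) preconditioner AMGK built for the matrix $M_0$ in place of $L$; finally, for $i=m,\dots,1$ do $\mathbf x\leftarrow\mathbf x+\hat\alpha_iS^{-1}(\mathbf v-L\mathbf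 x)$. For the recursion, on each level except the coarsest the current matrix is partitioned into $2\times2$ blocks with invertible square diagonal blocks, and $P,R,S^{-1}$ and the next coarse matrix are formed from these blocks by the formulas above. The $\mathrm{KSM}^\star$ calls in the hierarchy are the outermost one, for the system with matrix $L$, and all those made recursively on the coarse matrices. $\mathrm{KSM}^\star$ denotes any optimal Krylov subspace method, i.e. one whose iterates satisfy an optimality (minimization) property over the Krylov subspace, such as GMRES, MINRES, or, for Hermitian positive definite problems, CG; non-optimal methods such as FOM, QMR or BiCG are not included. ''In 2 iterations'' means that the exact solution is reached after at most 2 iterations. *)

(* Defs.v *)
From HB Require Import structures.
From mathcomp Require Import all_boot all_order all_algebra.
From mathcomp Require Import all_classical all_reals all_analysis.
From mathcomp Require Export complex.

Set Implicit Arguments.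
Unset Strict Implicit.
Unset Printing Implicit Defensive.

Import Order.TTheory GRing.Theory Num.Theory.
Local Open Scope ring_scope.
Local Open Scope complex_scope.

Section Blocks.
Context {R : realType} {n1 n2 : nat}.
Variable L : 'M[R[i]]_(n1 + n2).
Let A := ulsubmx L.
Let B := ursubmx L.
Let C := dlsubmx L.
Let D := drsubmx L.

Definition prolongation : 'M[R[i]]_(n1 + n2, n2) :=
  col_mx (- (invmx A *m B)) 1%:M.

Definition restriction : 'M[R[i]]_(n2, n1 + n2) :=
  row_mx (- (C *m invmx A)) 1%:M.

Definition smoother_inv : 'M[R[i]]_(n1 + n2) :=
  block_mx (invmx A) 0 0 (invmx D).

Definition coarse_mx : 'M[R[i]]_n2 := restriction *m L *m prolongation.

Definition diag_blocks_unit : bool := (A \in unitmx) && (D \in unitmx).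

End Blocks.

Lemma coarse_mxE (R : realType) (n1 n2 : nat)
    (A : 'M[R[i]]_n1) (B : 'M[R[i]]_(n1, n2))
    (C : 'M[R[i]]_(n2, n1)) (D : 'M[R[i]]_n2) :
  A \in unitmx ->
  coarse_mx (block_mx A B C D) = D - C *m invmx A *m B.
Proof.
move=> Au; rewrite /coarse_mx /restriction /prolongation.
rewrite block_mxKul block_mxKur block_mxKdl mul_row_block mul_row_col.
by rewrite !mul1mx mulmx1 !mulNmx mulmxKV // addNr mul0mx add0r addrC.
Qed.

(** A left preconditioner is an arbitrary map, since it may itself contain
    Krylov iterations and is then not linear by construction. *)
Notation precond R n := ('cV[R[i]]_n -> 'cV[R[i]]_n).

(** For the system [M x = b] with left preconditioner [W], [iterate M W b k] is
    the iterate after [k] iterations ([iterate M W b 0] is the initial guess,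
    chosen by the method) and [stop M W b] is the number of iterations after
    which the method returns. *)
Record ksm (R : realType) := Ksm {
  iterate : forall n, 'M[R[i]]_n -> precond R n -> 'cV[R[i]]_n ->
            nat -> 'cV[R[i]]_n;
  stop : forall n, 'M[R[i]]_n -> precond R n -> 'cV[R[i]]_n -> nat }.

Definition ksm_result (R : realType) (K : ksm R) n (M : 'M[R[i]]_n)
    (W : precond R n) (b : 'cV[R[i]]_n) : 'cV[R[i]]_n :=
  iterate K M W b (stop K M W b).

(** Span of [z, WMz, ..., (WM)^(k-1) z] with [z = W (b - M x0)]. *)
Definition krylov (R : realType) n (M : 'M[R[i]]_n) (W : precond R n)
    (b x0 : 'cV[R[i]]_n) (k : nat) : {vspace 'cV[R[i]]_n} :=
  <<traject (fun u => W (M *m u)) (W (b - M *m x0)) k>>%VS.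

Definition is_norm (R : realType) n (N : 'cV[R[i]]_n -> R) : Prop :=
  [/\ forall u v, N (u + v) <= N u + N v,
      forall (a : R[i]) u, N (a *: u) = ComplexField.Normc.normc a * N u &
      forall u, N u = 0 -> u = 0].

(** GMRES minimizes the Euclidean norm of the preconditioned residual, MINRES a
    norm of the residual, and CG (for Hermitian positive definite problems) the
    energy norm of the error. *)
Variant criterion := Error | Residual | PrecondResidual.

Definition discrepancy (R : realType) n (mu : criterion) (M : 'M[R[i]]_n)
    (W : precond R n) (b x : 'cV[R[i]]_n) : 'cV[R[i]]_n :=
  match mu with
  | Error => invmx M *m b - x
  | Residual => b - M *m x
  | PrecondResidual => W (b - M *m x)
  end.

(** The minimized quantity may depend on [M] and [W] (as for CG and MINRES), but
    not on the right-hand side; this excludes QMR-like quasi-minimization, whose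
    norm depends on the Krylov basis. *)
Definition ksm_optimal (R : realType) (K : ksm R) n (M : 'M[R[i]]_n)
    (W : precond R n) : Prop :=
  exists (mu : criterion) (N : 'cV[R[i]]_n -> R), is_norm N /\
    forall (b : 'cV[R[i]]_n) (k : nat),
      let x := iterate K M W b in
      x k - x 0%N \in krylov M W b (x 0%N) k /\
      forall y, y - x 0%N \in krylov M W b (x 0%N) k ->
        N (discrepancy mu M W b (x k)) <= N (discrepancy mu M W b y).

(** A call is not cut off before two iterations unless it has already found the
    exact solution. Iterating until convergence, and always performing a fixed
    number [>= 2] of iterations, are both covered. *)
Definition ksm_no_early_stop (R : realType) (K : ksm R) n (M : 'M[R[i]]_n)
    (W : precond R n) : Prop :=
  forall b : 'cV[R[i]]_n,
    M *m ksm_result K M W b = b \/ (2 <= stop K M W b)%N.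

Definition ksm_exact_within (R : realType) (K : ksm R) (s : nat) n
    (M : 'M[R[i]]_n) (W : precond R n) : Prop :=
  forall b : 'cV[R[i]]_n,
    exists2 k : nat, (k <= s)%N & M *m iterate K M W b k = b.

(** Sizes of the blocks on every level; [Coarsest n] is solved directly. *)
Inductive hierarchy : nat -> Type :=
  | Coarsest n : hierarchy n
  | TwoByTwo n1 n2 of hierarchy n2 : hierarchy (n1 + n2).

Definition alpha_hat (R : realType) (m i : nat) : R[i] :=
  (1 / (1 - cos (2 * pi * i%:R / (2 * m + 1)%:R)) : R)%:C.

Section Cycle.
Context {R : realType}.
Variable m : nat.

Definition relax n1 n2 (L : 'M[R[i]]_(n1 + n2)) (v x : 'cV[R[i]]_(n1 + n2))
    (i : nat) : 'cV[R[i]]_(n1 + n2) :=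
  x + alpha_hat R m i *: (smoother_inv L *m (v - L *m x)).

(** [solve] is the (exact or recursive) solver for the coarse matrix. *)
Definition kcycle n1 n2 (L : 'M[R[i]]_(n1 + n2)) (solve : precond R n2)
    (v : 'cV[R[i]]_(n1 + n2)) : 'cV[R[i]]_(n1 + n2) :=
  let x1 := foldl (relax L v) 0 (iota 1 m) in
  let y := solve (restriction L *m (v - L *m x1)) in
  let x2 := x1 + prolongation L *m y in
  foldl (relax L v) x2 (rev (iota 1 m)).

Variable K : ksm R.

Fixpoint coarse_solve n (h : hierarchy n) : 'M[R[i]]_n -> precond R n :=
  match h with
  | Coarsest _ => fun M r => invmx M *m r
  | TwoByTwo _ _ h' => fun M r =>
      ksm_result K M (kcycle M (coarse_solve h' (coarse_mx M))) r
  end.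

(** [h] describes the levels below [L]. *)
Definition amgk n1 n2 (h : hierarchy n2) (L : 'M[R[i]]_(n1 + n2)) :
    precond R (n1 + n2) :=
  kcycle L (coarse_solve h (coarse_mx L)).

(** [Q] holds for (matrix, preconditioner) of every Krylov call, from the
    outermost one down. *)
Fixpoint every_ksm_call (Q : forall n, 'M[R[i]]_n -> precond R n -> Prop)
    n (h : hierarchy n) : 'M[R[i]]_n -> Prop :=
  match h with
  | Coarsest _ => fun _ => True
  | TwoByTwo _ _ h' => fun M =>
      Q _ M (amgk h' M) /\ every_ksm_call Q h' (coarse_mx M)
  end.

End Cycle.

Fixpoint admissible (R : realType) n (h : hierarchy n) : 'M[R[i]]_n -> Prop :=
  match h with
  | Coarsest _ => fun _ => True
  | TwoByTwo _ _ h' => fun M =>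
      diag_blocks_unit M /\ admissible h' (coarse_mx M)
  end.

(* Main.v *)
Require Import Defs.
From mathcomp Require Import all_boot all_order all_algebra.
From mathcomp Require Import all_classical all_reals all_analysis.
From mathcomp Require Import ring zify.

(** On one level with blocks [A], [B], [C], [D], write [S^-1 L = 1 - X]; then [X]
    is block off-diagonal.  With an exact coarse solve the coarse correction
    multiplies the error by [J (1 - X)], where [J = diag(1, 0)]
    ([coarse_projectorE]), and each smoothing sweep multiplies it by [p(X)] with
    [p(t) = prod_i (1 - alpha_i (1 - t))].  So the cycle multiplies the error by
    [E = p(X) J (1 - X) p(X)].

    The weights make [p] proportional to the Chebyshev polynomial of the fourth
    kind [W], [W(cos s) = sin((2m+1) s/2) / sin(s/2)]: the roots of [p] are the
    [cos(2 pi i / (2m+1))], and [p(1) = 1] gives [p = W / (2m+1)] ([relax_poly]).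
    Since [(1 - cos s) W(cos s)^2 = 1 - cos((2m+1) s)], the polynomial
    [q = (1 - t) W^2] has even part 1 ([cheb4_parity]).  The two diagonal
    projections [J] and [1 - J] are exchanged by [X], so only the even part of
    [q] survives in [J q(X) J], which is therefore [J] ([cheb4_compression]).
    Hence [E^2 = c E] with [c = (2m+1)^-2], and [c <> 1] because [m >= 1]
    ([cycle_error_quadratic]).

    The cycle is thus a linear preconditioner [V] with [V L = 1 - E], and the
    quadratic equation for [E] expresses the identity as a combination of [V L]
    and [(V L)^2].  Applied to the initial error, this places the exact solution
    in the Krylov space of dimension 2, where optimality forces the method to
    find it ([ksm_optimal_exact]).

    A Krylov solver that performs at least two iterations, or stops early only at
    the exact solution, is thus an exact solver for its matrix.  Climbing from
    the coarsest level, this turns the nested Krylov calls into exact coarse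
    solves, and the one-level argument applies on every level
    ([hierarchy_exact]). *)

Set Implicit Arguments.
Unset Strict Implicit.
Unset Printing Implicit Defensive.

Import Order.TTheory GRing.Theory Num.Theory.
Local Open Scope ring_scope.
Local Open Scope complex_scope.

(** * Chebyshev polynomials of the fourth kind *)

(** The Chebyshev polynomial of the fourth kind of degree [k], evaluated at [x];
    [cheb4 'X k] is the polynomial itself.  Taking an arbitrary ring element as
    argument lets the same recursion serve for reals, polynomials and matrices. *)
Fixpoint cheb4 (S : pzRingType) (x : S) (k : nat) : S :=
  match k with
  | 0 => 1
  | 1 => x *+ 2 + 1
  | (k'.+1 as k1).+1 => x *+ 2 * cheb4 x k1 - cheb4 x k'
  end.

Lemma cheb4SS (S : pzRingType) (x : S) k :
  cheb4 x k.+2 = x *+ 2 * cheb4 x k.+1 - cheb4 x k.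
Proof. by []. Qed.

Lemma two_step_ind (P : nat -> Prop) :
  P 0 -> P 1 -> (forall k, P k -> P k.+1 -> P k.+2) -> forall k, P k.
Proof.
move=> P0 P1 PSS k; suff: P k /\ P k.+1 by case.
by elim: k => [|k [Pk PSk]]; split=> //; apply: PSS.
Qed.

Lemma rmorph_cheb4 (S S' : pzRingType) (f : {rmorphism S -> S'}) x k :
  f (cheb4 x k) = cheb4 (f x) k.
Proof.
elim/two_step_ind: k => [||k IH IHS]; first exact: rmorph1.
  by rewrite rmorphD rmorphMn rmorph1.
by rewrite !cheb4SS rmorphB rmorphM rmorphMn IH IHS.
Qed.

Lemma cheb4_at1 (S : pzRingType) k : cheb4 (1 : S) k = (2 * k + 1)%:R.
Proof.
elim/two_step_ind: k => [||k IH IHS] //; first by rewrite /= -mulrSr.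
rewrite cheb4SS IH IHS -natrM -natrB; last by lia.
by congr _%:R; lia.
Qed.

Lemma size_cheb4 (F : nzRingType) k :
  (size (cheb4 ('X : {poly F}) k) <= k.+1)%N.
Proof.
have size2X (p : {poly F}) : (size ('X *+ 2 * p)%R <= (size p).+1)%N.
  by rewrite mulrnAl -scaler_nat (leq_trans (size_scale_leq _ _)) //
       (leq_trans (size_polyMleq _ _)) // size_polyX.
elim/two_step_ind: k => [||k IH IHS]; first by rewrite size_poly1.
  rewrite /= -['X *+ 2]mulr1 (leq_trans (size_polyD _ _)) //.
  by rewrite geq_max size_poly1 (leq_trans (size2X _)) // size_poly1.
rewrite cheb4SS (leq_trans (size_polyD _ _)) // size_polyN geq_max.
by rewrite (leq_trans (size2X _)) ?(leq_trans IH) ?ltnS ?(leqW (leqnSn _)).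
Qed.

(** The trigonometric form that identifies the roots, with [t] half of the
    Chebyshev angle.  It rests on [sin(a+b) + sin(a-b) = 2 sin a cos b]. *)
Lemma cheb4_sin (R : realType) (t : R) k :
  cheb4 (cos (t *+ 2)) k * sin t = sin (t *+ (2 * k + 1)).
Proof.
have sinS (a b : R) : sin (a + b) = cos b *+ 2 * sin a - sin (a - b).
  by rewrite sinB sinD; ring.
elim/two_step_ind: k => [||k IH IHS]; first by rewrite mul1r.
  rewrite [LHS]/= (_ : t *+ (2 * 1 + 1) = t + t *+ 2); last by rewrite -mulrS.
  by rewrite sinS (_ : t - t *+ 2 = - t) ?sinN; ring.
rewrite cheb4SS mulrBl -mulrA IH IHS.
rewrite (_ : t *+ (2 * k.+2 + 1) = t *+ (2 * k.+1 + 1) + t *+ 2); last first.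
  by rewrite -mulrnDr; congr (_ *+ _); lia.
rewrite sinS (_ : t *+ (2 * k.+1 + 1) - t *+ 2 = t *+ (2 * k + 1)) //.
by rewrite -mulrnBr; [congr (_ *+ _)|]; lia.
Qed.

(** In trigonometric terms [x = cos s] turns this into
    [(1 - cos((2k+1) s)) + (1 + cos((2k+1) s)) = 2].  The algebraic proof carries
    along the same relation for two consecutive indices and a mixed one, which
    together are stable under the recursion. *)
Lemma cheb4_parity (S : comNzRingType) (x : S) k :
  (1 - x) * cheb4 x k ^+ 2 + (1 + x) * cheb4 (- x) k ^+ 2 = 2.
Proof.
suff: (1 - x) * cheb4 x k ^+ 2 + (1 + x) * cheb4 (- x) k ^+ 2 = 2 /\
  (1 - x) * cheb4 x k.+1 ^+ 2 + (1 + x) * cheb4 (- x) k.+1 ^+ 2 = 2 /\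
  (1 - x) * cheb4 x k * cheb4 x k.+1
    - (1 + x) * cheb4 (- x) k * cheb4 (- x) k.+1 = x *+ 2 by case.
elim: k => [|k [Ek [ESk Ex]]]; first by rewrite /=; do 2?split; ring.
split=> //; rewrite !cheb4SS; split; last first.
  transitivity (x *+ 2 * ((1 - x) * cheb4 x k.+1 ^+ 2 +
    (1 + x) * cheb4 (- x) k.+1 ^+ 2) - ((1 - x) * cheb4 x k * cheb4 x k.+1
    - (1 + x) * cheb4 (- x) k * cheb4 (- x) k.+1)); first by ring.
  by rewrite ESk Ex; ring.
transitivity (x ^+ 2 *+ 4 * ((1 - x) * cheb4 x k.+1 ^+ 2 +
    (1 + x) * cheb4 (- x) k.+1 ^+ 2)
    - x *+ 4 * ((1 - x) * cheb4 x k * cheb4 x k.+1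
      - (1 + x) * cheb4 (- x) k * cheb4 (- x) k.+1)
    + ((1 - x) * cheb4 x k ^+ 2 + (1 + x) * cheb4 (- x) k ^+ 2)); first by ring.
by rewrite ESk Ex Ek; ring.
Qed.

Lemma cheb4_anticomm (S : pzRingType) (s x : S) k :
  s * x = - x * s -> s * cheb4 x k = cheb4 (- x) k * s.
Proof.
move=> sx; have sx2 : s * (x *+ 2) = (- x) *+ 2 * s.
  by rewrite mulrnAr sx mulrnAl.
elim/two_step_ind: k => [||k IH IHS]; first by rewrite mulr1 mul1r.
  by rewrite [LHS]mulrDr [RHS]mulrDl sx2 mulr1 mul1r.
by rewrite !cheb4SS mulrBr mulrBl mulrA sx2 -!mulrA IHS IH.
Qed.

(** * The smoothing polynomial *)

Definition relax_angle (R : realType) (m i : nat) : R :=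
  2 * pi * i%:R / (2 * m + 1)%:R.

Lemma relax_angle_bounds (R : realType) m i : (0 < i <= m)%N ->
  0 < relax_angle R m i < pi.
Proof.
move=> /andP[i0 im]; have pi0 := pi_gt0 R.
have d0 : 0 < (2 * m + 1)%:R :> R by rewrite ltr0n addn1.
rewrite /relax_angle ltr_pdivrMr // divr_gt0 ?mulr_gt0 ?ltr0n ?addn1 //=.
rewrite -mulrA mulrCA ltr_pM2l // -natrM ltr_nat; lia.
Qed.

Lemma cos_relax_angle_inj (R : realType) m :
  {in iota 1 m &, injective (fun i => cos (relax_angle R m i))}.
Proof.
have range k : k \in iota 1 m -> (0 < k <= m)%N by rewrite mem_iota add1n ltnS.
have itv k : k \in iota 1 m -> relax_angle R m k \in `[0, pi].
  move=> /range/(relax_angle_bounds R)/andP[? ?].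
  by rewrite in_itv /= !ltW.
move=> i j ki kj /cos_inj E; have {E} := E (itv _ ki) (itv _ kj).
have pi0 : 2 * pi != 0 :> R by rewrite mulf_neq0 // gt_eqF // pi_gt0.
have d0 : (2 * m + 1)%:R != 0 :> R by rewrite addn1 pnatr_eq0.
move=> /(mulIf (invr_neq0 d0)) /(mulfI pi0) /eqP.
by rewrite eqr_nat => /eqP.
Qed.

Lemma cos_relax_angle_neq1 (R : realType) m i : (0 < i <= m)%N ->
  cos (relax_angle R m i) != 1.
Proof.
move=> /(relax_angle_bounds R)/andP[t0 tpi].
apply: contraTneq (t0) => E; rewrite -leNgt.
suff -> : relax_angle R m i = 0 by [].
by apply: cos_inj; rewrite ?cos0 ?in_itv /= ?(ltW t0) ?(ltW tpi) ?lexx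
                               ?pi_ge0.
Qed.

(** At this angle [sin((2m+1) s/2)] is [sin(i pi) = 0], while [sin(s/2)] is not
    zero. *)
Lemma cheb4_root (R : realType) m i : (0 < i <= m)%N ->
  cheb4 (cos (relax_angle R m i)) m = 0.
Proof.
move=> im; have /andP[t0 tpi] := relax_angle_bounds R im.
have half : relax_angle R m i / 2 *+ 2 = relax_angle R m i.
  by rewrite -mulr_natr mulfVK.
have s0 : sin (relax_angle R m i / 2) != 0.
  rewrite gt_eqF // sin_gt0_pi // divr_gt0 //=.
  by rewrite (lt_trans _ tpi) // gtr_pMr // invf_lt1 // ltr1n.
apply: (mulIf s0); rewrite mul0r -{1}half cheb4_sin.
rewrite (_ : _ *+ (2 * m + 1) = pi *+ i); last first.
  rewrite -(mulr_natr _ (2 * m + 1)) /relax_angle -(mulr_natr pi).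
  have d0 : (2 * m + 1)%:R != 0 :> R by rewrite addn1 pnatr_eq0.
  by move: (2 * m + 1)%:R d0 => d d0; field.
elim: i {im t0 tpi half s0} => [|j IH]; first by rewrite mulr0n sin0.
by rewrite mulrSr sinDpi IH oppr0.
Qed.

(** Both sides vanish at the [m] distinct points [cos(2 pi i/(2m+1))], have degree
    [m], and take the value 1 at 1. *)
Lemma relax_poly (R : realType) m :
  \prod_(i <- iota 1 m)
    (1 - (1 / (1 - cos (relax_angle R m i)))%:P * (1 - 'X)) =
  (2 * m + 1)%:R^-1 *: cheb4 'X m :> {poly R}.
Proof.
set w := cheb4 'X m; set c := fun i => cos (relax_angle R m i).
have range k : k \in iota 1 m -> (0 < k <= m)%N by rewrite mem_iota add1n ltnS.
have hornerw x : w.[x] = cheb4 x m.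
  by rewrite -[LHS]/(horner_eval x w) rmorph_cheb4 /= /horner_eval hornerX.
have w1 : w.[1] = (2 * m + 1)%:R by rewrite hornerw cheb4_at1.
have d0 : (2 * m + 1)%:R != 0 :> R by rewrite addn1 pnatr_eq0.
have w0 : w != 0 by apply: contraNneq d0 => w0; rewrite -w1 w0 horner0.
pose rs := map c (iota 1 m).
(* [m] distinct roots force the degree to be exactly [m] and split [w]. *)
have uniq_rs : uniq rs.
  by rewrite map_inj_in_uniq ?iota_uniq //; exact: cos_relax_angle_inj.
have root_rs : all (root w) rs.
  apply/allP => _ /mapP[i /range im ->].
  by rewrite rootE hornerw cheb4_root.
have size_rs : size rs = m by rewrite size_map size_iota.
have size_w : size w = (size rs).+1.
  apply/eqP; rewrite eqn_leq (max_poly_roots w0 root_rs uniq_rs) size_rs.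
  by rewrite size_cheb4.
have := all_roots_prod_XsubC size_w root_rs.
rewrite uniq_rootsE => /(_ uniq_rs).
set p := \prod_(z <- rs) _ => wE.
have p1 : p.[1] = \prod_(i <- iota 1 m) (1 - c i).
  rewrite horner_prod big_map; apply: eq_bigr => i _.
  by rewrite hornerXsubC.
have lc : lead_coef w * p.[1] = (2 * m + 1)%:R by rewrite -w1 {2}wE hornerZ.
have a0 : lead_coef w != 0.
  by move: d0; rewrite -lc mulf_eq0 negb_or => /andP[].
transitivity (p.[1]^-1 *: p); last first.
  rewrite [w in RHS]wE scalerA; congr (_ *: _); rewrite -lc.
  by rewrite invfM mulrAC mulVf // mul1r.
rewrite -mul_polyC p1 -prodfV rmorph_prod /= /p big_map -big_split /=.
apply: eq_big_seq => i /range im.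
have c1 : 1 - c i != 0 by rewrite subr_eq0 eq_sym cos_relax_angle_neq1.
rewrite -/(c i) div1r.
have E : ((1 - c i)^-1)%:P * (1 - (c i)%:P) = 1 :> {poly R}.
  by rewrite -polyC1 -polyCB -polyCM mulVf.
by rewrite -[X in X - _]E; ring.
Qed.

(** * Smoothing and coarse correction as matrices *)

(** The factors commute, being polynomials in [X]; this is why the order of the
    weights is immaterial.  Matrices of size 0 form the zero ring, outside the
    reach of polynomial evaluation, and are treated apart. *)
Lemma relax_product_mx (R : realType) m n (X : 'M[R[i]]_n) (s : seq nat) :
  perm_eq s (iota 1 m) ->
  \prod_(i <- s) (1 - alpha_hat R m i *: (1 - X)) =
  (2 * m + 1)%:R^-1 *: cheb4 X m.
Proof.
case: n X => [|n] X s_perm; first by rewrite [LHS]flatmx0 [RHS]flatmx0.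
pose f : {rmorphism {poly R} -> 'M[R[i]]_n.+1} :=
  horner_mx X \o map_poly (real_complex R).
have fX : f 'X = X by rewrite /f /= map_polyX horner_mx_X.
have fC a : f a%:P = (a%:C)%:M by rewrite /f /= map_polyC horner_mx_C.
transitivity (f (\prod_(i <- iota 1 m)
    (1 - (1 / (1 - cos (relax_angle R m i)))%:P * (1 - 'X)))).
  rewrite -(perm_big _ s_perm) rmorph_prod; apply: eq_bigr => i _.
  by rewrite rmorphB rmorph1 rmorphM fC rmorphB rmorph1 fX -mul_scalar_mx.
rewrite relax_poly -mul_polyC rmorphM fC rmorph_cheb4 fX.
by rewrite [LHS]mul_scalar_mx rmorphV ?unitfE ?pnatr_eq0 ?addn1 // rmorph_nat.
Qed.

Lemma cheb4_parity_mx (F : comNzRingType) n (X : 'M[F]_n) k :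
  (1 - X) * cheb4 X k ^+ 2 + (1 + X) * cheb4 (- X) k ^+ 2 = 1 *+ 2.
Proof.
case: n X => [|n] X; first by rewrite [LHS]flatmx0 [RHS]flatmx0.
have : exists f : {rmorphism {poly F} -> 'M[F]_n.+1}, f 'X = X.
  by exists (horner_mx X); exact: horner_mx_X.
move=> [f <-]; have /(congr1 f) := cheb4_parity ('X : {poly F}) k.
by rewrite !(rmorphD, rmorphB, rmorphM, rmorphXn, rmorph_cheb4, rmorphN)
           rmorph1.
Qed.

(** The hypotheses say that [s = 2J - 1] anticommutes with [X].  Conjugation by
    [s] thus replaces [X] by [-X], but leaves a product [J q(X) J] unchanged, which
    is then equal to [J q(-X) J]; the average of the two is [J] by
    [cheb4_parity_mx]. *)
Lemma cheb4_compression (F : numFieldType) n (X J : 'M[F]_n) k :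
  J * J = J -> J * X = X * (1 - J) ->
  J * ((1 - X) * cheb4 X k ^+ 2) * J = J.
Proof.
move=> JJ JX; pose s : 'M[F]_n := J *+ 2 - 1.
have Js : J * s = J by rewrite mulrBr mulrnAr JJ mulr1 mulr2n addrK.
have sJ : s * J = J by rewrite mulrBl mulrnAl JJ mul1r mulr2n addrK.
have sX : s * X = - X * s.
  rewrite mulrBl mulrBr mulrnAl mulrnAr JX mulr1 mul1r mulrBr mulr1 mulNr.
  by rewrite mulrnBl mulNrn opprK mulr2n addrAC addrK addrC.
clearbody s.
pose q (x : 'M[F]_n) := (1 - x) * cheb4 x k ^+ 2.
have sq : s * q X = q (- X) * s.
  have s1X : s * (1 - X) = (1 - - X) * s.
    by rewrite mulrBr mulrBl sX mulr1 mul1r.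
  rewrite /q mulrA s1X -!mulrA; congr (_ * _).
  rewrite !expr2 [LHS]mulrA (cheb4_anticomm k sX) -[LHS]mulrA.
  by rewrite (cheb4_anticomm k sX) mulrA.
have even : J * q X * J = J * q (- X) * J.
  by rewrite -{1}Js -(mulrA J) sq -!mulrA sJ.
have twice : J * q X * J *+ 2 = J *+ 2.
  rewrite mulr2n {2}even -mulrDl -mulrDr /q opprK cheb4_parity_mx.
  by rewrite mulrnAr mulr1 mulrnAl JJ.
move: twice; rewrite -!scaler_nat; apply: scalerI.
by rewrite pnatr_eq0.
Qed.

(** The inner part [J (1 - X) p(X)^2 J] of [E * E] collapses to a multiple of
    [J]. *)
Lemma cycle_error_quadratic (R : realType) m n (X J : 'M[R[i]]_n)
    (s1 s2 : seq nat) (P := fun s : seq nat =>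
      \prod_(i <- s) (1 - alpha_hat R m i *: (1 - X)))
    (E := P s2 * (J * (1 - X)) * P s1) :
  perm_eq s1 (iota 1 m) -> perm_eq s2 (iota 1 m) ->
  J * J = J -> J * X = X * (1 - J) ->
  E * E = (2 * m + 1)%:R^-1 ^+ 2 *: E.
Proof.
move=> perm1 perm2 JJ JX; rewrite /E /P !relax_product_mx //.
set a := _^-1; set w := cheb4 X m.
have scaleAl (d : R[i]) (A B : 'M[R[i]]_n) : (d *: A) * B = d *: (A * B).
  by rewrite [RHS]scalemxAl.
have scaleAr (d : R[i]) (A B : 'M[R[i]]_n) : A * (d *: B) = d *: (A * B).
  by rewrite [RHS]scalemxAr.
rewrite !(scaleAl, scaleAr) !scalerA.
have := cheb4_compression m JJ JX; rewrite -/w expr2 => compress.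
have -> : w * (J * (1 - X)) * w * (w * (J * (1 - X)) * w) =
    w * (J * (1 - X)) * w.
  transitivity (w * (J * ((1 - X) * (w * w)) * J) * ((1 - X) * w)).
    by rewrite !mulrA.
  by rewrite compress !mulrA.
by congr (_ *: _); rewrite expr2 !mulrA.
Qed.

(** * Optimal Krylov methods under a quadratic relation *)

Lemma norm0 (R : realType) n (N : 'cV[R[i]]_n -> R) : is_norm N -> N 0 = 0.
Proof.
case=> _ NZ _; rewrite -(scale0r (0 : 'cV[R[i]]_n)) NZ.
by rewrite ComplexField.Normc.normc0 mul0r.
Qed.

Lemma norm_ge0 (R : realType) n (N : 'cV[R[i]]_n -> R) u :
  is_norm N -> 0 <= N u.
Proof.
move=> normN; have [ND NZ _] := normN.
have := ND u (- u); rewrite subrr norm0 // -scaleN1r NZ.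
by rewrite normcN ComplexField.Normc.normc1 mul1r -mulr2n
           pmulrn_lge0.
Qed.

(** Applied to the initial error [e], the quadratic relation reads
    [e = a z + d W (M z)] with [z] the first Krylov vector, so the exact solution
    competes in the minimization.  Its discrepancy is 0, hence so is that of the
    iterate, and a zero discrepancy means a solved system because [U], like [M],
    is injective. *)
Lemma ksm_optimal_exact (R : realType) (K : ksm R) n (M U : 'M[R[i]]_n)
    (W : precond R n) (a d : R[i]) :
  M \in unitmx -> (forall v, W v = U *m (invmx M *m v)) ->
  a *: U + d *: (U *m U) = 1%:M -> ksm_optimal K M W ->
  forall b k, (2 <= k)%N -> M *m iterate K M W b k = b.
Proof.
move=> Mu WE quad [mu [N [normN opt]]] b k k2.
have [_] := opt b k; set x := iterate K M W b => min_xk.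
pose xs := invmx M *m b.
have Mxs : M *m xs = b by rewrite mulKVmx.
have W0 : W 0 = 0 by rewrite WE !mulmx0.
have xs_krylov : xs - x 0%N \in krylov M W b (x 0%N) k.
  set e := xs - x 0%N; set z := W (b - M *m x 0%N).
  have zE : z = U *m e by rewrite /z WE mulmxBr mulKmx.
  have -> : e = a *: z + d *: W (M *m z).
    rewrite -[LHS]mul1mx -quad mulmxDl -!scalemxAl -mulmxA -zE.
    by rewrite WE mulKmx.
  (* For two or more iterations the first two Krylov vectors are available. *)
  case: k k2 {min_xk} => [|[|k]] // _.
  by rewrite rpredD // rpredZ //= memv_span // !inE eqxx ?orbT.
have := min_xk _ xs_krylov.
have -> : discrepancy mu M W b xs = 0.
  by case: mu {min_xk opt} => /=; rewrite ?Mxs ?subrr.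
rewrite norm0 // => N_le0.
have : discrepancy mu M W b (x k) = 0.
  by case: (normN) => _ _; apply; apply/eqP; rewrite eq_le N_le0 norm_ge0.
have U_inj u : U *m u = 0 -> u = 0.
  move=> Uu; rewrite -[u]mul1mx -quad mulmxDl -!scalemxAl.
  by rewrite -mulmxA Uu mulmx0 !scaler0 addr0.
case: mu {min_xk opt N_le0} => /=.
- by move/subr0_eq <-.
- by move/subr0_eq.
rewrite WE => /U_inj /(congr1 (mulmx M)).
by rewrite mulmx0 mulKVmx // => /subr0_eq.
Qed.

(** * One level with an exact coarse solve *)

Section TwoLevel.
Variables (R : realType) (m n1 n2 : nat) (L : 'M[R[i]]_(n1 + n2)).
Hypotheses (L_unit : L \in unitmx) (L_diag : diag_blocks_unit L).

Let G := smoother_inv L *m L.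
Let J : 'M[R[i]]_(n1 + n2) := block_mx 1%:M 0 0 0.
Let A_unit : ulsubmx L \in unitmx. Proof. by case/andP: L_diag. Qed.
Let D_unit : drsubmx L \in unitmx. Proof. by case/andP: L_diag. Qed.

Lemma smoothed_mxE : G = block_mx 1%:M (invmx (ulsubmx L) *m ursubmx L)
                                 (invmx (drsubmx L) *m dlsubmx L) 1%:M.
Proof.
rewrite /G -{2}[L]submxK mulmx_block !mul0mx !addr0 !add0r.
by rewrite !mulVmx.
Qed.

Lemma block_projector : J * J = J.
Proof. by rewrite [LHS]mulmx_block !mulmx0 !mul0mx mul1mx !addr0. Qed.

(** [1 - G] is block off-diagonal, so it carries each block space to the other. *)
Lemma block_projector_swap : J * (1 - G) = (1 - G) * (1 - J).
Proof.
have id_block : (1 : 'M[R[i]]_(n1 + n2)) = block_mx 1%:M 0 0 1%:M.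
  exact: scalar_mx_block.
have -> : 1 - J = block_mx 0 0 0 1%:M.
  by rewrite id_block opp_block_mx add_block_mx !subrr !oppr0 !addr0.
rewrite smoothed_mxE id_block opp_block_mx add_block_mx !subrr !add0r.
rewrite [LHS]mulmx_block [RHS]mulmx_block.
by rewrite !mul1mx !mulmx1 !mul0mx !mulmx0 !addr0 !add0r.
Qed.

Lemma restrictionL : restriction L *m L = row_mx 0 (coarse_mx L).
Proof.
rewrite -{2 3}[L]submxK coarse_mxE // -{1}[L]submxK /restriction.
rewrite block_mxKul block_mxKdl.
rewrite mul_row_block !mul1mx !mulNmx mulmxKV // addNr.
by rewrite addrC.
Qed.

(** Clearing the upper right block of [L] by a unipotent factor shows that
    [det L = det A * det (coarse_mx L)]. *)
Lemma coarse_mx_unit : coarse_mx L \in unitmx.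
Proof.
rewrite -[L]submxK coarse_mxE //.
set A := ulsubmx L; set B := ursubmx L; set C := dlsubmx L; set D := drsubmx L.
have LE : L *m block_mx 1%:M (- (invmx A *m B)) 0 1%:M =
    block_mx A 0 C (D - C *m invmx A *m B).
  rewrite -[L]submxK mulmx_block !mulmx1 !mulmx0 !addr0 !mulmxN mulmxA.
  by rewrite mulmxV // mul1mx addNr mulmxA addrC.
have := congr1 determinant LE.
rewrite det_mulmx det_ublock det_lblock !det1 !mulr1 => detE.
by move: L_unit; rewrite !unitmxE detE unitrM => /andP[].
Qed.

(** As [R L = (0, M0)], the coarse correction only sees the second block of the
    error; it removes that block and adds [A^-1 B] times it to the first one. *)
Lemma coarse_projectorE :
  1 - prolongation L *m (invmx (coarse_mx L) *m (restriction L *m L)) =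
  J *m G.
Proof.
rewrite restrictionL mul_mx_row mulmx0 mulVmx ?coarse_mx_unit //.
rewrite /prolongation mul_col_row !mulmx0 !mulmx1 smoothed_mxE.
rewrite [RHS]mulmx_block !mul0mx !mul1mx !addr0.
rewrite [1 in LHS](scalar_mx_block n1 n2 1) opp_block_mx add_block_mx.
by rewrite !oppr0 !addr0 opprK add0r subrr.
Qed.

Lemma relax_error v x s :
  invmx L *m v - foldl (relax m L v) x s =
  (\prod_(i <- rev s) (1 - alpha_hat R m i *: G)) *m (invmx L *m v - x).
Proof.
elim: s x => [|i s IH] x /=; first by rewrite big_nil mul1mx.
rewrite IH rev_cons -cats1 big_cat /= big_seq1 -mulmxA.
congr (_ *m _); rewrite /relax mulmxBl mul1mx -scalemxAl.
rewrite /G -(mulmxA _ L) (mulmxBr L).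
by rewrite mulKVmx // opprD addrA.
Qed.

Lemma coarse_correction_error (v x : 'cV[R[i]]_(n1 + n2)) :
  invmx L *m v - (x + prolongation L *m
    (invmx (coarse_mx L) *m (restriction L *m (v - L *m x)))) =
  J *m G *m (invmx L *m v - x).
Proof.
rewrite -coarse_projectorE mulmxBl mul1mx -!mulmxA (mulmxBr L) mulKVmx //.
by rewrite opprD addrA.
Qed.

(** Here [1 - U] is the error propagation matrix [E] of the whole cycle, with
    [E^2 = c E]; the coefficients come from eliminating [E] between [U = 1 - E]
    and [U^2 = 1 - (2 - c) E]. *)
Lemma kcycle_quadratic (solve : precond R n2) : (0 < m)%N ->
  (forall r, solve r = invmx (coarse_mx L) *m r) ->
  exists (U : 'M[R[i]]_(n1 + n2)) (a d : R[i]),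
    (forall v, kcycle m L solve v = U *m (invmx L *m v)) /\
    a *: U + d *: (U *m U) = 1%:M.
Proof.
move=> m0 solveE; pose F (s : seq nat) : 'M[R[i]]_(n1 + n2) :=
  \prod_(i <- s) (1 - alpha_hat R m i *: G).
pose E := F (iota 1 m) * (J * G) * F (rev (iota 1 m)).
set c : R[i] := (2 * m + 1)%:R^-1 ^+ 2.
have EE : E *m E = c *: E.
  have := @cycle_error_quadratic R m _ (1 - G) J (rev (iota 1 m)) (iota 1 m).
  rewrite subKr; apply; rewrite ?perm_rev //; first exact: block_projector.
  exact: block_projector_swap.
have c1 : 1 - c != 0.
  rewrite /c subr_eq0 eq_sym lt_eqF // exprn_ilt1 ?invr_ge0 ?ler0n //.
  by rewrite invf_lt1 ?ltr0n ?ltr1n; lia.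
exists (1%:M - E), ((2 - c) / (1 - c)), (- (1 - c)^-1); split=> [v|].
  rewrite mulmxBl mul1mx /kcycle.
  rewrite -[LHS](subKr (invmx L *m v)) relax_error revK solveE.
  rewrite coarse_correction_error relax_error subr0.
  by rewrite -[E]/(F _ *m (J *m G) *m F _) -!mulmxA.
clearbody E; rewrite mulmxBl mulmxBr !mul1mx mulmxBr mulmx1 EE.
apply/matrixP=> i j; rewrite !mxE.
move: ((i == j)%:R : R[i]) (E i j : R[i]) => u e.
by field.
Qed.
End TwoLevel.

(** * The hierarchy *)

(** Exactness of the nested solver has to be part of the induction: it is what
    makes the preconditioner of the next finer level linear. *)
Lemma hierarchy_exact (R : realType) (m : nat) (K : ksm R) n (h : hierarchy n)
    (M : 'M[R[i]]_n) :
  (0 < m)%N -> M \in unitmx -> admissible h M ->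
  every_ksm_call m K (@ksm_optimal R K) h M ->
  every_ksm_call m K (@ksm_no_early_stop R K) h M ->
  every_ksm_call m K (@ksm_exact_within R K 2) h M /\
  forall r, coarse_solve m K h M r = invmx M *m r.
Proof.
move=> m0; elim: h M => [//|n1 n2 h IH] M Mu /=.
move=> [Mdiag adm] [opt opts] [stop stops].
have [exacts solveE] := IH _ (coarse_mx_unit Mu Mdiag) adm opts stops.
have [U [a [d [WE quad]]]] := kcycle_quadratic Mu Mdiag m0 solveE.
have exact_from2 := ksm_optimal_exact Mu WE quad opt.
split=> [|r]; first by split=> // b; exists 2%N; rewrite ?exact_from2.
apply: (canRL (mulKmx Mu)).
by have [|/exact_from2 E] := stop r; [|rewrite /= /ksm_result E].
Qed.

Theorem lemma4p2 (R : realType) (n1 n2 : nat)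
    (A : 'M[R[i]]_n1) (B : 'M[R[i]]_(n1, n2))
    (C : 'M[R[i]]_(n2, n1)) (D : 'M[R[i]]_n2)
    (L : 'M[R[i]]_(n1 + n2)) (defL : L = block_mx A B C D)
    (L_unit : L \in unitmx) (A_unit : A \in unitmx) (D_unit : D \in unitmx)
    (T_diag : diagonalizable (invmx A *m B *m invmx D *m C))
    (m : nat) (m_gt0 : (1 <= m)%N)
    (h : hierarchy n2) (h_adm : admissible h (coarse_mx L))
    (K : ksm R)
    (K_opt : every_ksm_call m K (@ksm_optimal R K) (TwoByTwo n1 h) L)
    (K_stop : every_ksm_call m K (@ksm_no_early_stop R K) (TwoByTwo n1 h) L) :
  every_ksm_call m K (@ksm_exact_within R K 2) (TwoByTwo n1 h) L.
Proof.
have L_adm : admissible (TwoByTwo n1 h) L.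
  by split=> //; rewrite /diag_blocks_unit defL block_mxKul block_mxKdr A_unit.
by have [] := hierarchy_exact m_gt0 L_unit L_adm K_opt K_stop.
Qed.
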